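(* Let $M,N:\mathbb{R}_+^2\to\mathbb{R}$ be symmetric, homogeneous means with $N$ continuous, suppose that $N$ is a harmonic representation of $M$, and let $n$ be the Seiffert function of $N$. If the function $u\mapsto n(u)/u$ is convex on $(0,1)$, then for all $x,y>0$ $$H(A(x,y),N(x,y))\le M(x,y)\le N\left(\frac{3x+y}{4},\frac{x+3y}{4}\right)$$ and, moreover, $$H\left(A(x,y),N^{\{1/2\}}(x,y),N^{\{1/2\}}(x,y),N(x,y)\right)\le M(x,y)\le N\left(\frac{3x+y}{4},\frac{x+3y}{4}\right).$$ If instead $u\mapsto n(u)/u$ is concave on $(0,1)$, then all of these inequalities hold with the inequality signs reversed.
   Context: $\mathbb{R}_+=(0,\infty)$. A mean is a function $M:\mathbb{R}_+^2\to\mathbb{R}$ with $\min(x,y)\le M(x,y)\le\max(x,y)$ for all $x,y>0$; it is symmetric if $M(x,y)=M(y,x)$ and homogeneous if $M(\lambda x,\lambda y)=\lambda M(x,y)$ for all $\lambda>0$. The Seiffert function of a symmetric homogeneous mean $N$ is $n(z)=\frac{z}{N(1-z,1+z)}$, $0<z<1$; it satisfies $\frac{z}{1+z}\le n(z)\le\frac{z}{1-z}$. For a mean $N$ and $0\le t\le 1$, $N^{\{t\}}(x,y)=N\left(\frac{x+y}{2}+t\frac{x-y}{2},\frac{x+y}{2}-t\frac{x-y}{2}\right)$. A continuous mean $N$ is a harmonic representation of $M$ if $\frac{1}{M(x,y)}=\int_0^1\frac{dt}{N^{\{t\}}(x,y)}$ for all $x,y>0$. $A(x,y)=\frac{x+y}{2}$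 is the arithmetic mean, and $H$ is the harmonic mean of its arguments: $H(a_1,\dots,a_k)=\frac{k}{\frac1{a_1}+\dots+\frac1{a_k}}$; in particular $H(a,b)=\frac{2ab}{a+b}$. *)

(* Defs.v *)
From mathcomp Require Import all_boot all_order all_algebra.
From mathcomp Require Import all_classical all_reals all_analysis.

Set Implicit Arguments.
Unset Strict Implicit.
Unset Printing Implicit Defensive.

Import Order.TTheory GRing.Theory Num.Theory.
Import numFieldNormedType.Exports.

Local Open Scope classical_set_scope.
Local Open Scope ring_scope.

(** Functions of two positive reals are represented by total functions
    [R -> R -> R]; every property below only constrains their values at
    positive arguments. *)

Definition is_mean (R : realType) (M : R -> R -> R) : Prop :=
  forall x y : R, 0 < x -> 0 < y ->
    Num.min x y <= M x y <= Num.max x y.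

Definition symmetric_mean (R : realType) (M : R -> R -> R) : Prop :=
  forall x y : R, 0 < x -> 0 < y -> M x y = M y x.

Definition homogeneous_mean (R : realType) (M : R -> R -> R) : Prop :=
  forall l x y : R, 0 < l -> 0 < x -> 0 < y -> M (l * x) (l * y) = l * M x y.

Definition continuous_mean (R : realType) (M : R -> R -> R) : Prop :=
  {within [set p : R * R | 0 < p.1 /\ 0 < p.2],
    continuous (fun p : R * R => M p.1 p.2)}.

Definition seiffert (R : realType) (N : R -> R -> R) (z : R) : R :=
  z / N (1 - z) (1 + z).

(** [tmean N t] is $N^{\{t\}}$. For [0 <= t <= 1] and positive [x], [y], both
    arguments passed to [N] are positive. *)
Definition tmean (R : realType) (N : R -> R -> R) (t x y : R) : R :=
  N ((x + y) / 2 + t * ((x - y) / 2)) ((x + y) / 2 - t * ((x - y) / 2)).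

(** The integrand is continuous on [[0, 1]] for a continuous mean [N], so the
    Lebesgue integral here is the Riemann integral. *)
Definition harmonic_representation (R : realType) (N M : R -> R -> R) : Prop :=
  [/\ is_mean N, continuous_mean N &
    forall x y : R, 0 < x -> 0 < y ->
      (M x y)^-1 =
      \int[@lebesgue_measure R]_(t in `[0, 1]) (tmean N t x y)^-1].

Definition arith_mean (R : realType) (x y : R) : R := (x + y) / 2.

Definition harm_mean (R : realType) (s : seq R) : R :=
  (size s)%:R / \sum_(a <- s) a^-1.

Definition concave_function (R : realType) (D : set R) (f : R -> R) : Prop :=
  @convex_function R R^o D (fun u => - f u).

(* Main.v *)
Require Import Defs.
From mathcomp Require Import all_boot all_order all_algebra.
From mathcomp Require Import all_classical all_reals all_analysis.
From mathcomp Require Import ring lra.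

Set Implicit Arguments.
Unset Strict Implicit.
Unset Printing Implicit Defensive.

Import Order.TTheory GRing.Theory Num.Theory.
Import numFieldNormedType.Exports.

Local Open Scope classical_set_scope.
Local Open Scope ring_scope.

(** With A = (x + y) / 2, z = |x - y| / (x + y) and g(u) = n(u) / u, symmetry
    and homogeneity give 1 / N^{t}(x, y) = g(t z) / A.  Hence the integrand f
    defining 1 / M is convex on ]0, 1[ when g is, and on [0, 1] by continuity,
    with f(0) = 1 / A and f(1) = 1 / N(x, y).  The claims are the
    Hermite-Hadamard inequalities for f, and the finer one is the upper bound
    applied on each half of [0, 1].  The concave case is the same for - f. *)

(** * Convexity and continuity on a segment *)

Lemma convex_functionP (R : realType) (D : set R) (f : R -> R) :
  @convex_function R R^o D f <->
  forall t x y : R, 0 <= t <= 1 -> D x -> D y ->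
    f (t * x + (1 - t) * y) <= t * f x + (1 - t) * f y.
Proof.
split=> [cf t x y /andP[t0 t1] Dx Dy|cf t x y /[!inE] Dx Dy].
  by have := cf (Itv01 t0 t1) x y (mem_set Dx) (mem_set Dy).
by apply: cf => //; rewrite ge0 le1.
Qed.

Lemma continuous_within_comp (T U V : topologicalType) (A : set T) (B : set U)
    (g : T -> U) (f : U -> V) :
  continuous g -> (forall t, A t -> B (g t)) ->
  {within B, continuous f} -> {within A, continuous (f \o g)}.
Proof.
move=> cg gAB /subspace_continuousP cf; apply/subspace_continuousP => t At.
apply: cvg_comp (cf _ (gAB _ At)) => P BP.
by apply: (@filterS T (nbhs t) _ _ _ _ (cg t _ BP)) => u /= gu /gAB; exact: gu.
Qed.

Lemma continuous_affine (R : realType) (p q : R) :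
  continuous (fun t : R => p * t + q).
Proof.
by move=> t; apply: cvgD; [apply: cvgMr; exact: cvg_id|exact: cvg_cst].
Qed.

(** For [0 < s < 1] the contraction of ratio [1 - s] towards the midpoint sends [[a, b]] into []a,
    b[]. This makes the end points limits of interior points, moved by one map that serves all
    points at once. *)
Lemma cvg_shrink_segment (R : realType) (f : R -> R) (a b x : R) :
  a < b -> {within `[a, b], continuous f} -> a <= x <= b ->
  f (x + s * ((a + b) / 2 - x)) @[s --> 0^'+] --> f x.
Proof.
move=> ab cf xab; pose g s := ((a + b) / 2 - x) * s + x.
have gE s : x + s * ((a + b) / 2 - x) = g s by rewrite /g; ring.
have : {within `[0, 1], continuous (f \o g)}.
  apply: (continuous_within_comp _ _ cf); first exact: continuous_affine.
  by move=> s; rewrite /= !in_itv /= /g => s01; apply/andP; split; nra.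
move=> /continuous_within_itvP => /(_ ltr01)[_ + _].
by under eq_fun do rewrite gE; rewrite /= {2}/g mulr0 add0r.
Qed.

(** The contraction [p s] towards the midpoint is affine, hence commutes with convex combinations.
    The inequality at the contracted points, which are interior, therefore passes to the limit as
    [s] tends to 0 from the right. *)
Lemma convex_function_oo_cc (R : realType) (f : R -> R) (a b : R) :
  a < b -> {within `[a, b], continuous f} ->
  @convex_function R R^o `]a, b[ f -> @convex_function R R^o `[a, b] f.
Proof.
move=> ab cf /convex_functionP cvx; apply/convex_functionP => t x y t01.
rewrite /= !in_itv /= => xab yab.
have zab : a <= t * x + (1 - t) * y <= b by apply/andP; split; nra.
pose p s u := u + s * ((a + b) / 2 - u).
have cvgp u : a <= u <= b -> f (p s u) @[s --> 0^'+] --> f u.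
  by move=> uab; exact: cvg_shrink_segment.
apply: (@ler_cvg_to _ ((0 : R)^'+) _ _ (fun s => f (p s (t * x + (1 - t) * y)))
  (fun s => t * f (p s x) + (1 - t) * f (p s y))).
- exact: cvgp.
- by apply: cvgD; apply: cvgMr; exact: cvgp.
near=> s.
have s0 : 0 < s by near: s; exact: nbhs_right_gt.
have s1 : s < 1 by near: s; exact: nbhs_right_lt.
have -> : p s (t * x + (1 - t) * y) = t * p s x + (1 - t) * p s y.
  by rewrite /p; ring.
by apply: cvx => //; rewrite /p /= in_itv /=; apply/andP; split; nra.
Unshelve. all: by end_near. Qed.

(** * Integrals over a segment and the Hermite-Hadamard inequalities *)

Lemma integrable_segment (R : realType) (f : R -> R) (a b : R) :
  {within `[a, b], continuous f} ->
  (@lebesgue_measure R).-integrable `[a, b] (EFin \o f).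
Proof.
by move=> cf; apply: continuous_compact_integrable cf; exact: segment_compact.
Qed.

(** Serves both bounds below: with the chord of [f] for the upper one, and with a constant, [p = 0],
    for the lower one. *)
Lemma Rintegral_affine (R : realType) (a b p q : R) : a < b ->
  \int[@lebesgue_measure R]_(t in `[a, b]) (p * t + q) =
  (b - a) * (p * ((a + b) / 2) + q).
Proof.
move=> ab; pose F (t : R) := p / 2 * (t * t) + q * t.
have dF (t : R) : is_derive t 1 F (p * t + q).
  by apply: is_derive_eq; rewrite /GRing.scale /=; field.
have cF : continuous F.
  by move=> t; apply/differentiable_continuous/derivable1_diffP.
rewrite /Rintegral (continuous_FTC2 (F := F)) //.
- by rewrite -EFinB /= /F; field.
- by apply: continuous_subspaceT; exact: continuous_affine.
- split=> [u _||].
  + exact: ex_derive.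
  + by apply: cvg_at_right_filter; exact: cF.
  + by apply: cvg_at_left_filter; exact: cF.
- by move=> t _; rewrite derive1E derive_val.
Qed.

(** A convex function lies below the chord joining its end points; integrate the chord. *)
Lemma hermite_hadamard_right (R : realType) (f : R -> R) (a b : R) :
  a < b -> {within `[a, b], continuous f} ->
  @convex_function R R^o `[a, b] f ->
  \int[@lebesgue_measure R]_(t in `[a, b]) f t <= (b - a) * ((f a + f b) / 2).
Proof.
move=> ab cf /convex_functionP cvx.
have ba0 : b - a != 0 by rewrite subr_eq0 gt_eqF.
(* Slope and intercept of the chord through [(a, f a)] and [(b, f b)]. *)
pose p := (f b - f a) / (b - a); pose q := (b * f a - a * f b) / (b - a).
have -> : (b - a) * ((f a + f b) / 2) = (b - a) * (p * ((a + b) / 2) + q).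
  by rewrite /p /q; field.
rewrite -Rintegral_affine //; apply: le_Rintegral => //.
- exact: integrable_segment.
- by apply/integrable_segment/continuous_subspaceT; exact: continuous_affine.
move=> t; rewrite /= in_itv /= => /andP[at_ tb].
(* The weight of [a] when [t] is written as a convex combination of [a] and [b]. *)
pose s := (b - t) / (b - a).
have s01 : 0 <= s <= 1.
  by rewrite /s divr_ge0 ?subr_ge0 ?(ltW ab) // ler_pdivrMr ?subr_gt0 //; lra.
have -> : p * t + q = s * f a + (1 - s) * f b by rewrite /p /q /s; field.
have {1}-> : t = s * a + (1 - s) * b by rewrite /s; field.
by apply: cvx => //=; rewrite in_itv /= lexx ltW.
Qed.

Lemma Rintegral_reflect (R : realType) (f : R -> R) (a b : R) :
  a < b -> {within `[a, b], continuous f} ->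
  \int[@lebesgue_measure R]_(t in `[a, b]) f t =
  \int[@lebesgue_measure R]_(t in `[a, b]) f (a + b - t).
Proof.
move=> ab cf; pose F (t : R) := a + b - t.
have Fa : F a = b by rewrite /F; ring.
have Fb : F b = a by rewrite /F; ring.
have dF (t : R) : is_derive t 1 F (-1).
  by apply: is_derive_eq; rewrite /=; ring.
have F'E : (F^`())%classic = cst (-1).
  by apply/funext => t; rewrite derive1E derive_val.
have cF : continuous F.
  by move=> t; apply/differentiable_continuous/derivable1_diffP.
have := @integration_by_substitution_decreasing R F f a b.
rewrite Fa Fb F'E /Rintegral => -> //.
- by congr fine; apply: eq_integral => t _ /=; rewrite opprK mulr1.
- exact: ltW.
- by move=> u v _ _ uv; rewrite /F; lra.
- by move=> t _; exact: cvg_cst.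
- exact: is_cvg_cst.
- exact: is_cvg_cst.
- split=> [t _||].
  + exact: ex_derive.
  + by apply: cvg_at_right_filter; exact: cF.
  + by apply: cvg_at_left_filter; exact: cF.
Qed.

(** No supporting line is used: the midpoint of [t] and [a + b - t] is always that of [[a, b]], so
    convexity bounds twice the value there by [f t + f (a + b - t)], and both terms have the same
    integral by reflection. *)
Lemma hermite_hadamard_left (R : realType) (f : R -> R) (a b : R) :
  a < b -> {within `[a, b], continuous f} ->
  @convex_function R R^o `[a, b] f ->
  (b - a) * f ((a + b) / 2) <= \int[@lebesgue_measure R]_(t in `[a, b]) f t.
Proof.
move=> ab cf /convex_functionP cvx; set I := Rintegral _ _ _.
have Ir : I = \int[@lebesgue_measure R]_(t in `[a, b]) f (a + b - t).
  exact: Rintegral_reflect.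
have cr : {within `[a, b], continuous (fun t => f (a + b - t))}.
  apply: (continuous_within_comp _ _ cf).
    by move=> t; apply: cvgB; [exact: cvg_cst|exact: cvg_id].
  by move=> t; rewrite /= !in_itv /= => /andP[? ?]; apply/andP; split; lra.
(* The left side is shaped as the integral of an affine function of slope 0. *)
have : (b - a) * (0 * ((a + b) / 2) + 2 * f ((a + b) / 2)) <= I + I.
  rewrite {2}Ir -Rintegral_affine // -RintegralD //; last 2 first.
  - exact: integrable_segment cf.
  - exact: integrable_segment cr.
  apply: le_Rintegral => //.
  - by apply/integrable_segment/continuous_subspaceT; exact: continuous_affine.
  - apply: integrable_segment => t; apply: cvgD; [exact: cf|exact: cr].
  move=> t; rewrite /= in_itv /= => /andP[? ?]; rewrite mul0r add0r.
  have := cvx (1 / 2) t (a + b - t).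
  have -> : 1 / 2 * t + (1 - 1 / 2) * (a + b - t) = (a + b) / 2 by field.
  rewrite /= !in_itv /=.
  have -> : 0 <= (1 / 2 : R) <= 1 by apply/andP; split; lra.
  have -> : a <= t <= b by apply/andP; split; lra.
  have -> : a <= a + b - t <= b by apply/andP; split; lra.
  by move=> /(_ isT isT isT); lra.
by lra.
Qed.

(** The midpoint is an end point of both halves, so its value is counted twice; this is why
    $N^{\{1/2\}}$ is repeated in the finer harmonic mean. *)
Lemma hermite_hadamard_right_bisect (R : realType) (f : R -> R) (a b : R) :
  a < b -> {within `[a, b], continuous f} ->
  @convex_function R R^o `[a, b] f ->
  \int[@lebesgue_measure R]_(t in `[a, b]) f t <=
  (b - a) * ((f a + f ((a + b) / 2) + f ((a + b) / 2) + f b) / 4).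
Proof.
move=> ab cf cvx; set m := (a + b) / 2.
have am : a < m by rewrite /m; lra.
have mb : m < b by rewrite /m; lra.
have sub1 : `[a, m] `<=` `[a, b] by apply: subset_itvl; rewrite bnd_simp ltW.
have sub2 : `[m, b] `<=` `[a, b] by apply: subset_itvr; rewrite bnd_simp ltW.
have cvxS (D : set R) : D `<=` `[a, b] -> @convex_function R R^o D f.
  move=> DS; apply/convex_functionP => t x y t01 /DS Dx /DS Dy.
  by move/convex_functionP : cvx; exact.
have I1 :=
  hermite_hadamard_right am (continuous_subspaceW sub1 cf) (cvxS _ sub1).
have I2 :=
  hermite_hadamard_right mb (continuous_subspaceW sub2 cf) (cvxS _ sub2).
have split_int : \int[@lebesgue_measure R]_(t in `[a, b]) f t =
    \int[@lebesgue_measure R]_(t in `[a, m]) f t +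
    \int[@lebesgue_measure R]_(t in `[m, b]) f t.
  have := @Rintegral_itvB R f (BLeft a) (BRight b) m (integrable_segment cf).
  rewrite !bnd_simp (ltW am) (ltW mb) => /(_ isT isT).
  (* Removing [[a, m]] leaves []m, b]]; adding the null point [m] does not change the integral. *)
  rewrite Rintegral_itv_obnd_cbnd => [<-|]; first by rewrite addrC subrK.
  apply: integrableS (integrable_segment cf) => //.
  by apply: subset_itvr; rewrite bnd_simp ltW.
have mE : m - a = (b - a) / 2 /\ b - m = (b - a) / 2 by rewrite /m; lra.
by move: I1 I2; rewrite split_int mE.1 mE.2; lra.
Qed.

(** * The integrand in terms of the Seiffert function *)

Lemma inv_tmeanE (R : realType) (N : R -> R -> R) (t x y : R) :
  symmetric_mean N -> homogeneous_mean N -> 0 < x -> 0 < y ->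
  let u := t * (`|x - y| / (x + y)) in 0 < u < 1 ->
  (tmean N t x y)^-1 = (arith_mean x y)^-1 * (seiffert N u / u).
Proof.
move=> N_sym N_hom x0 y0 u /andP[u0 u1].
have xy0 : x + y != 0 by rewrite gt_eqF ?addr_gt0.
have A0 : 0 < arith_mean x y by rewrite /arith_mean; lra.
rewrite /seiffert mulrAC divff ?gt_eqF // mul1r -invfM; congr _^-1.
have [v0 v1] : 0 < 1 - u /\ 0 < 1 + u by lra.
(* Scaling [1 - u] and [1 + u] by the arithmetic mean gives the two arguments in [tmean], in reverse
   order when [y <= x]; symmetry repairs that case. *)
rewrite -N_hom // /tmean.
have [xy|xy] := leP y x.
  have uE : u = t * ((x - y) / (x + y)) by rewrite /u ger0_norm ?subr_ge0.
  by rewrite [RHS]N_sym; [|exact: mulr_gt0..]; congr (N _ _);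
    rewrite uE /arith_mean; field.
have uE : u = t * ((y - x) / (x + y)) by rewrite /u distrC gtr0_norm ?subr_gt0.
by congr (N _ _); rewrite uE /arith_mean; field.
Qed.

Lemma tmean_args_gt0 (R : realType) (t x y : R) :
  0 <= t <= 1 -> 0 < x -> 0 < y ->
  0 < (x + y) / 2 + t * ((x - y) / 2) /\ 0 < (x + y) / 2 - t * ((x - y) / 2).
Proof. by move=> /andP[? ?] ? ?; split; nra. Qed.

Lemma mean_gt0 (R : realType) (N : R -> R -> R) (x y : R) :
  is_mean N -> 0 < x -> 0 < y -> 0 < N x y.
Proof.
move=> Nm x0 y0; have /andP[+ _] := Nm x y x0 y0.
by apply: lt_le_trans; rewrite lt_min x0.
Qed.

Lemma continuous_inv_tmean (R : realType) (N : R -> R -> R) (x y : R) :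
  is_mean N -> continuous_mean N -> 0 < x -> 0 < y ->
  {within `[0, 1], continuous (fun t => (tmean N t x y)^-1)}.
Proof.
move=> N_mean N_cont x0 y0.
pose g (t : R) := ((x + y) / 2 + t * ((x - y) / 2),
                   (x + y) / 2 - t * ((x - y) / 2)).
have cg : continuous g.
  have cu (c d : R) : continuous (fun t : R => c + t * d).
    by move=> t; apply: cvgD; [exact: cvg_cst|apply: cvgMl; exact: cvg_id].
  have cv (c d : R) : continuous (fun t : R => c - t * d).
    by move=> t; apply: cvgB; [exact: cvg_cst|apply: cvgMl; exact: cvg_id].
  by move=> t; apply: cvg_pair (cu _ _ t) (cv _ _ t).
have gS t : `[0, 1]%classic t -> 0 < (g t).1 /\ 0 < (g t).2.
  by rewrite /= in_itv /= => t01; exact: tmean_args_gt0.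
have /subspace_continuousP cN := continuous_within_comp cg gS N_cont.
apply/subspace_continuousP => t t01; have [g1 g2] := gS t t01.
by apply: cvgV (cN t t01); rewrite /= gt_eqF // mean_gt0.
Qed.

(** The substitution [t * z] is linear and keeps []0, 1[] inside itself since [0 < z < 1], and the
    factor [1 / A] is positive, so convexity is inherited. The scalar [e] covers the convex case
    with 1 and the concave case with -1. *)
Lemma convex_inv_tmean (R : realType) (N : R -> R -> R) (e x y : R) :
  symmetric_mean N -> homogeneous_mean N -> 0 < x -> 0 < y ->
  @convex_function R R^o `]0, 1[ (fun u => e * (seiffert N u / u)) ->
  @convex_function R R^o `]0, 1[ (fun t => e * (tmean N t x y)^-1).
Proof.
move=> N_sym N_hom x0 y0 /convex_functionP cvx.
apply/convex_functionP => t a b t01; rewrite /= !in_itv /= => ab01 bb01.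
(* Here [z] would be 0, where [seiffert N u / u] takes the default value 0 instead of the limit 1;
   but then the integrand is constant in [t]. *)
have [->|xy] := eqVneq x y.
  by rewrite /tmean subrr mul0r !mulr0 -mulrDl [t + _]addrC subrK mul1r.
set z := `|x - y| / (x + y).
have z0 : 0 < z by rewrite divr_gt0 ?addr_gt0 ?normr_gt0 ?subr_eq0.
have z1 : z < 1.
  by rewrite ltr_pdivrMr ?addr_gt0 // mul1r ltr_norml; apply/andP; split; lra.
have zI s : 0 < s < 1 -> 0 < s * z < 1.
  by move=> /andP[s0 s1]; rewrite mulr_gt0 //=; nra.
have ab : 0 < t * a + (1 - t) * b < 1.
  case/andP: t01 ab01 bb01 => t0 t1 /andP[a0 a1] /andP[b0 b1].
  have t1' : 0 <= 1 - t by lra.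
  by apply/andP; split; have [?|?] := leP a b; nra.
rewrite !inv_tmeanE ?zI // -/z.
have A0 : 0 <= (arith_mean x y)^-1.
  by rewrite invr_ge0 /arith_mean divr_ge0 // ltW // addr_gt0.
have := cvx t (a * z) (b * z) t01; rewrite /= !in_itv /= !zI // => /(_ isT isT).
have -> : t * (a * z) + (1 - t) * (b * z) = (t * a + (1 - t) * b) * z by ring.
move=> /(ler_wpM2l A0); set p := arith_mean x y.
by congr (_ <= _); ring.
Qed.

(** * Harmonic means and the final inequalities *)

Lemma inv_harm_mean (R : realType) (s : seq R) :
  (harm_mean s)^-1 = (\sum_(a <- s) a^-1) / (size s)%:R.
Proof. by rewrite /harm_mean invf_div. Qed.

Lemma harm_mean_gt0 (R : realType) (s : seq R) :
  (0 < size s)%N -> all (fun a => 0 < a) s -> 0 < harm_mean s.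
Proof.
case: s => // a s _ /= /andP[a0 /allP s0].
rewrite /harm_mean divr_gt0 ?ltr0n // big_cons.
rewrite ltr_wpDr ?invr_gt0 // big_seq.
by apply: sumr_ge0 => b bs; rewrite invr_ge0 ltW // s0.
Qed.

Theorem mainTheorem3 (R : realType) (M N : R -> R -> R)
    (M_mean : is_mean M) (M_sym : symmetric_mean M)
    (M_hom : homogeneous_mean M)
    (N_mean : is_mean N) (N_sym : symmetric_mean N)
    (N_hom : homogeneous_mean N) (N_cont : continuous_mean N)
    (N_rep : harmonic_representation N M) :
  (@convex_function R R^o `]0, 1[ (fun u => seiffert N u / u) ->
    forall x y : R, 0 < x -> 0 < y ->
      (harm_mean [:: arith_mean x y; N x y] <= M x y
         <= N ((3 * x + y) / 4) ((x + 3 * y) / 4)) /\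
      (harm_mean [:: arith_mean x y; tmean N (1 / 2) x y;
                     tmean N (1 / 2) x y; N x y] <= M x y
         <= N ((3 * x + y) / 4) ((x + 3 * y) / 4)))
  /\
  (concave_function `]0, 1[ (fun u => seiffert N u / u) ->
    forall x y : R, 0 < x -> 0 < y ->
      (N ((3 * x + y) / 4) ((x + 3 * y) / 4) <= M x y
         <= harm_mean [:: arith_mean x y; N x y]) /\
      (N ((3 * x + y) / 4) ((x + 3 * y) / 4) <= M x y
         <= harm_mean [:: arith_mean x y; tmean N (1 / 2) x y;
                          tmean N (1 / 2) x y; N x y])).
Proof.
(* All bounds are first proved for reciprocals, where they are linear in the integral and the
   harmonic means become arithmetic means; the sign [e] lets one argument serve both halves of the
   theorem. *)
have scaled_bounds (e x y : R) : 0 < x -> 0 < y ->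
    @convex_function R R^o `]0, 1[ (fun u => e * (seiffert N u / u)) ->
    [/\ e * (N ((3 * x + y) / 4) ((x + 3 * y) / 4))^-1 <= e * (M x y)^-1,
      e * (M x y)^-1 <= e * (harm_mean [:: arith_mean x y; N x y])^-1 &
      e * (M x y)^-1 <= e * (harm_mean [:: arith_mean x y;
        tmean N (1 / 2) x y; tmean N (1 / 2) x y; N x y])^-1].
  move=> x0 y0 cvx; have [_ _ ->//] := N_rep.
  pose f t := (tmean N t x y)^-1.
  have cf : {within `[0, 1], continuous f} by exact: continuous_inv_tmean.
  have cef : {within `[0, 1], continuous (fun t => e * f t)}.
    by move=> t; apply: cvgMr; exact: cf.
  have cvxf : @convex_function R R^o `[0, 1] (fun t => e * f t).
    by apply: convex_function_oo_cc => //; exact: convex_inv_tmean.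
  have fm : f 2^-1 = (N ((3 * x + y) / 4) ((x + 3 * y) / 4))^-1.
    by rewrite /f /tmean; congr (N _ _)^-1; field.
  have f0 : f 0 = (arith_mean x y)^-1.
    rewrite /f /tmean mul0r addr0 subr0 -/(arith_mean x y); congr _^-1.
    have A0 : 0 < arith_mean x y by rewrite /arith_mean; lra.
    (* On the diagonal the minimum and maximum coincide, which forces [N A A = A]. *)
    by have := N_mean _ _ A0 A0; rewrite minxx maxxx; case/andP => ? ?; lra.
  have f1 : f 1 = (N x y)^-1 by rewrite /f /tmean; congr (N _ _)^-1; field.
  have := hermite_hadamard_left ltr01 cef cvxf.
  have := hermite_hadamard_right ltr01 cef cvxf.
  have := hermite_hadamard_right_bisect ltr01 cef cvxf.
  rewrite RintegralZl //; last exact: integrable_segment.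
  rewrite !inv_harm_mean !big_cons !big_nil /= add0r subr0 !mul1r.
  rewrite -f0 -f1 -/(f 2^-1) fm.
  by split; lra.
have pos (x y : R) : 0 < x -> 0 < y ->
  [/\ 0 < M x y, 0 < N ((3 * x + y) / 4) ((x + 3 * y) / 4),
      0 < harm_mean [:: arith_mean x y; N x y] &
      0 < harm_mean [:: arith_mean x y; tmean N (1 / 2) x y;
                        tmean N (1 / 2) x y; N x y]].
  move=> x0 y0; have N0 := mean_gt0 N_mean x0 y0.
  have A0 : 0 < arith_mean x y by rewrite /arith_mean; lra.
  have T0 : 0 < tmean N (1 / 2) x y.
    by rewrite /tmean; apply: mean_gt0 => //; lra.
  split; [exact: mean_gt0|by apply: mean_gt0 => //; lra|..];
    by apply: harm_mean_gt0; rewrite //= ?A0 ?T0 ?N0.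
(* Positivity permits taking inverses, which reverses the inequalities; with [e = -1] the sign
   reverses them once more. *)
split=> cvx x y x0 y0; have [M0 B0 H0 K0] := pos x y x0 y0.
  have [|] := scaled_bounds 1 x y x0 y0.
    apply/convex_functionP => t a b; rewrite !mul1r.
    by move/convex_functionP: cvx; exact.
  by move: K0; rewrite !mul1r => K0; rewrite !lef_pV2 // => -> -> ->.
have [|] := scaled_bounds (-1) x y x0 y0.
  apply/convex_functionP => t a b; rewrite !mulN1r.
  by move/convex_functionP: cvx; exact.
by rewrite !mulN1r !lerN2 !lef_pV2 // => -> -> ->.
Qed.
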